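(* Let $S=K[x_1,\ldots,x_n,y_1,\ldots,y_n]$ be the polynomial ring in $2n$ variables over a field $K$ and let $$X=\begin{bmatrix} x_1 & x_2 & \cdots & x_n\\ z_1 & z_2 & \cdots & z_n\end{bmatrix},$$ where $z_1,\ldots,z_n$ are pairwise distinct elements of $\{x_1,\ldots,x_n,y_1,\ldots,y_n\}$ and $z_i\neq x_i$ for all $i=1,\ldots,n$. Then the ideal of $S$ generated by all $2$-minors of $X$ is prime if and only if the directed graph $G_X$ contains no directed cycle.
   Context: $G_X$ is the directed graph on the vertex set $\{1,\ldots,n\}$ in which, for $1\le i,j\le n$, there is a directed edge from $i$ to $j$ if and only if $x_i=z_j$. (There are no loops since $z_i\ne x_i$.) A directed cycle of length $r\ge 2$ consists of distinct vertices $v_1,\ldots,v_r$ such that there are edges $v_i\to v_{i+1}$ for $i=1,\ldots,r-1$ and an edge $v_r\to v_1$; in particular a pair of edges $u\to v$, $v\to u$ forms a directed cycle of length $2$. *)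

(* Defs.v *)
From mathcomp Require Import all_boot all_order all_algebra.
From mathcomp Require Export ring_quotient boolp mpoly.

Set Implicit Arguments.
Unset Strict Implicit.
Unset Printing Implicit Defensive.

Import GRing.Theory.
Local Open Scope ring_scope.

(* The ideal generated by a subset [G] of a commutative ring.  Membership is
   undecidable in general; it is made boolean classically, so that the ideal
   predicates of [ring_quotient] apply. *)
Definition ideal_gen (R : comNzRingType) (G : R -> Prop) : {pred R} :=
  [pred p | `[< exists s : seq (R * R),
      (forall c, c \in s -> G c.2) /\ p = \sum_(c <- s) c.1 * c.2 >]].

(* [idealr_closed] includes properness: [1 \notin I]. *)
Definition prime_ideal (R : comNzRingType) (I : {pred R}) : Prop :=
  idealr_closed I /\ prime_idealr_closed I.

Definition is_minor (R : comNzRingType) (m n k : nat) (A : 'M[R]_(m, n))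
    (p : R) : Prop :=
  exists (f : 'I_k -> 'I_m) (g : 'I_k -> 'I_n),
    [/\ {homo f : i j / (i < j)%N}, {homo g : i j / (i < j)%N}
      & p = \det (mxsub f g A)].

(* The 2n variables of S = K[x_1, ..., x_n, y_1, ..., y_n] are split as
   n x-variables followed by n y-variables. *)
Definition xvar (K : fieldType) (n : nat) (i : 'I_n) : {mpoly K[n + n]} :=
  'X_(lshift n i).

Definition yvar (K : fieldType) (n : nat) (i : 'I_n) : {mpoly K[n + n]} :=
  'X_(rshift n i).

Definition Xmx (K : fieldType) (n : nat) (z : 'I_n -> {mpoly K[n + n]}) :
    'M[{mpoly K[n + n]}]_(1 + 1, n) :=
  col_mx (\row_j xvar K j) (\row_j z j).

Definition GX (K : fieldType) (n : nat) (z : 'I_n -> {mpoly K[n + n]}) :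
    rel 'I_n :=
  [rel i j | xvar K i == z j].

(* [ucycle e c] : [c] is duplicate-free, with an edge from each of its
   elements to the next and from the last one to the first. *)
Definition has_directed_cycle (T : eqType) (e : rel T) : Prop :=
  exists c : seq T, (2 <= size c)%N /\ ucycle e c.

(* Main.v *)
(* If [v_1 -> ... -> v_r -> v_1] is a cycle, the columns of [X] at these vertices
   are [(a_(k+1); a_k)], with indices modulo [r], and
   [(a_2 - a_1) * \sum_k a_k = \sum_k (a_2 a_k - a_1 a_(k+1))] lies in the ideal,
   while no nonzero linear form does, the ideal being generated in degree 2.
   If there is no cycle, [f : x_j |-> z_j] leads from every variable [u] to a
   y-variable [r u] in [d u] steps, so that [X] is the matrix of a rational normal
   scroll: the ideal is the kernel of the toric map [u |-> s_(r u) * t ^ d u]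
   into a polynomial ring.  Indeed, exchanging columns connects any two monomials
   with the same image. *)
Require Import Defs.
From mathcomp Require Import all_boot all_order all_algebra.
From mathcomp Require Import zify.

Set Implicit Arguments.
Unset Strict Implicit.
Unset Printing Implicit Defensive.

Import GRing.Theory.
Local Open Scope ring_scope.

(** * Ideals generated by a set *)

Section IdealGen.
Variables (R : comNzRingType) (G : R -> Prop).

Lemma ideal_gen0 : 0 \in ideal_gen G.
Proof. by apply/asboolP; exists [::]; rewrite big_nil. Qed.

Lemma mem_ideal_gen g : G g -> g \in ideal_gen G.
Proof.
move=> Gg; apply/asboolP; exists [:: (1, g)].
by split=> [c|]; [rewrite inE => /eqP-> | rewrite big_seq1 mul1r].
Qed.

Lemma ideal_genD p q :
  p \in ideal_gen G -> q \in ideal_gen G -> p + q \in ideal_gen G.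
Proof.
move=> /asboolP[s [Gs ->]] /asboolP[t [Gt ->]]; apply/asboolP; exists (s ++ t).
by split=> [c|]; [rewrite mem_cat => /orP[/Gs|/Gt] | rewrite big_cat].
Qed.

Lemma ideal_genM a p : p \in ideal_gen G -> a * p \in ideal_gen G.
Proof.
move=> /asboolP[s [Gs ->]]; apply/asboolP.
exists [seq (a * c.1, c.2) | c <- s].
split=> [_ /mapP[c cs ->]|]; first exact: (Gs c).
by rewrite big_map mulr_sumr; apply: eq_bigr => c _ /=; rewrite mulrA.
Qed.

Lemma ideal_genN p : p \in ideal_gen G -> - p \in ideal_gen G.
Proof. by rewrite -mulN1r; apply: ideal_genM. Qed.

Lemma ideal_gen_sum (I : eqType) (s : seq I) (F : I -> R) :
  {in s, forall i, F i \in ideal_gen G} -> \sum_(i <- s) F i \in ideal_gen G.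
Proof.
move=> FG; rewrite big_seq; apply: (big_ind (fun p => p \in ideal_gen G)) => //.
- exact: ideal_gen0.
- exact: ideal_genD.
Qed.

Lemma ideal_gen_ind (P : R -> Prop) :
  P 0 -> (forall p q, P p -> P q -> P (p + q)) ->
  (forall a g, G g -> P (a * g)) -> {in ideal_gen G, forall p, P p}.
Proof.
move=> P0 PD PM p /asboolP[s [Gs ->]]; rewrite big_seq.
by apply: big_ind => // c /Gs; apply: PM.
Qed.

End IdealGen.

(* In each fibre of [W] over [msupp p] the coefficients of [p] add up to zero,
   and all the monomials of the fibre are congruent modulo the ideal. *)
Lemma mem_ideal_gen_fiber (K : fieldType) (N M : nat)
    (G : {mpoly K[N]} -> Prop) (W : 'X_{1..N} -> 'X_{1..M}) :
  (forall m m', W m = W m' -> 'X_[m] - 'X_[m'] \in ideal_gen G) ->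
  forall p : {mpoly K[N]},
  \sum_(m <- msupp p) p@_m *: 'X_[K, W m] = 0 -> p \in ideal_gen G.
Proof.
move=> GW p p0; pose s := msupp p.
(* [rho w] is the first monomial of the support with weight [w]; the default [0%MM] is never reached
   for a weight that occurs. *)
pose rho w := nth 0%MM s (index w (map W s)).
have W_rho m : m \in s -> W (rho (W m)) = W m.
  move=> ms; rewrite -(nth_map _ 0%MM) ?nth_index ?map_f //.
  by rewrite -(size_map W) index_mem map_f.
suff rho0: \sum_(m <- s) p@_m *: 'X_[K, rho (W m)] = 0.
  have -> : p = \sum_(m <- s) p@_m *: 'X_[m]
              - \sum_(m <- s) p@_m *: 'X_[K, rho (W m)].
    by rewrite rho0 subr0 -mpolyE.
  rewrite -sumrB; apply: ideal_gen_sum => m ms; rewrite -scalerBr -mul_mpolyC.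
  by apply/ideal_genM/GW; rewrite W_rho.
pose t := undup (map W s).
(* Grouping by weight turns the coefficient of each [rho w] into the coefficient at [w] of the sum
   in [p0], which is zero. *)
transitivity (\sum_(m <- s) \sum_(w <- t | W m == w) p@_m *: 'X_[K, rho w]).
  rewrite !big_seq; apply: eq_bigr => m ms.
  rewrite big_mkcond (bigD1_seq (W m)) ?undup_uniq ?mem_undup ?map_f //= eqxx.
  by rewrite big1 ?addr0 // => w; rewrite eq_sym => /negPf->.
rewrite (exchange_big_dep predT) //= big1 // => w _.
rewrite -scaler_suml (_ : \sum_(m <- s | _) _ = 0) ?scale0r //.
move/(congr1 (mcoeff w)): p0; rewrite mcoeff0 raddf_sum /= => cw.
rewrite -[RHS]cw big_mkcond; apply: eq_bigr => m _; rewrite mcoeffZ mcoeffX.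
by case: eqP; rewrite ?mulr1 ?mulr0.
Qed.

Lemma mnm_gt0P (N : nat) (m : 'X_{1..N}) (u : 'I_N) :
  (0 < m u)%N -> exists m', m = (U_(u) + m')%MM.
Proof.
move=> mu; exists (m - U_(u))%MM; rewrite addmC submK //.
by apply/mnm_lepP => v; rewrite mnm1E; case: eqP => // <-.
Qed.

(** * Primality of scroll ideals *)

Section Scroll.
(** The matrix has a column with entries [u] and [f u] for each [u] in [D]; [r u] and [d u] are the
    end and the length of the path from [u] under [f] until it leaves [D]. *)
Variables (K : fieldType) (N : nat) (f : 'I_N -> 'I_N) (D : {pred 'I_N}).
Variables (r : 'I_N -> 'I_N) (d : 'I_N -> nat).
Hypothesis f_inj : {in D &, injective f}.
Hypothesis rd : forall u,
  if u \in D then r u = r (f u) /\ d u = (d (f u)).+1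
  else r u = u /\ d u = 0%N.
Variable G : {mpoly K[N]} -> Prop.
Hypothesis mem_minor : {in D &, forall u v,
  'X_u * 'X_(f v) - 'X_v * 'X_(f u) \in ideal_gen G}.
Hypothesis minor_of_G : forall g, G g -> exists u v,
  [/\ u \in D, v \in D & g = 'X_u * 'X_(f v) - 'X_v * 'X_(f u)].

(* Exponent vector of [s_(r u) * t ^ d u]: the variable [t] has index [ord0]. *)
Definition var_weight u : 'X_{1..N.+1} :=
  (U_(lift ord0 (r u)) + U_(ord0) *+ d u)%MM.

Definition weight (m : 'X_{1..N}) : 'X_{1..N.+1} :=
  (\sum_u var_weight u *+ m u)%MM.

Lemma depth_gt0 u : (0 < d u)%N = (u \in D).
Proof. by case: (u \in D) (rd u) => -[_ ->]. Qed.

(** Paths can be retraced from their common end, since [f] is injective on [D]. *)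
Lemma root_depth_inj u v : r u = r v -> d u = d v -> u = v.
Proof.
elim/ltn_ind: (d u) {-2}u (erefl (d u)) v => k IHk {}u du v ruv duv.
move: (rd u) (rd v) (depth_gt0 u) (depth_gt0 v); rewrite -duv du.
case: ifP => uD; case: ifP => vD; last 3 first.
- by move=> [_ ->].
- by move=> [_ ->].
- by rewrite ruv => -[-> _] [].
move=> [ru duf] [rv dvf] _ _; apply: f_inj => //.
apply: (IHk (d (f u))) => //; first by rewrite duf.
  by rewrite -ru -rv.
by apply: succn_inj; rewrite -duf dvf.
Qed.

Lemma weight_root m u :
  weight m (lift ord0 (r u)) = (\sum_(v | r v == r u) m v)%N.
Proof.
rewrite mnm_sumE [RHS]big_mkcond; apply: eq_bigr => v _.
rewrite mulmnE mnmDE mulmnE !mnm1E (inj_eq lift_inj) mul0n addn0.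
by case: eqP; rewrite ?mul1n.
Qed.

Lemma weight_depth m : weight m ord0 = (\sum_v d v * m v)%N.
Proof.
rewrite mnm_sumE; apply: eq_bigr => v _.
by rewrite mulmnE mnmDE mulmnE !mnm1E eqxx mul1n.
Qed.

Lemma weightD m m' : weight (m + m')%MM = (weight m + weight m')%MM.
Proof.
apply/mnmP => k; rewrite mnmDE !mnm_sumE -big_split /=; apply: eq_bigr => v _.
by rewrite !mulmnE mnmDE mulnDr.
Qed.

Lemma weightU u : weight U_(u)%MM = var_weight u.
Proof.
apply/mnmP => k; rewrite mnm_sumE (bigD1 u) //= mulmnE mnm1E eqxx muln1.
by rewrite big1 ?addn0 // => v /negPf vu; rewrite mulmnE mnm1E eq_sym vu muln0.
Qed.

Lemma var_weight_exchange u v : u \in D -> v \in D ->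
  (var_weight u + var_weight (f v) = var_weight v + var_weight (f u))%MM.
Proof.
move=> uD vD; move: (rd u) (rd v); rewrite uD vD => -[ru du] [rv dv].
apply/mnmP => k; rewrite /var_weight !(mnmDE, mulmnE) ru rv du dv.
by rewrite !mulnS !addnA; lia.
Qed.

Definition mnm_cong (m m' : 'X_{1..N}) := 'X_[m] - 'X_[m'] \in ideal_gen G.

Lemma mnm_cong_refl m : mnm_cong m m.
Proof. by rewrite /mnm_cong subrr ideal_gen0. Qed.

Lemma mnm_cong_sym m m' : mnm_cong m m' -> mnm_cong m' m.
Proof. by move=> /ideal_genN; rewrite opprB. Qed.

Lemma mnm_cong_trans m' m m'' :
  mnm_cong m m' -> mnm_cong m' m'' -> mnm_cong m m''.
Proof. by move=> mm' /(ideal_genD mm'); rewrite addrA subrK. Qed.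

Lemma mnm_congD m'' m m' : mnm_cong m m' -> mnm_cong (m'' + m) (m'' + m').
Proof. by move=> mm'; rewrite /mnm_cong !mpolyXD -mulrBr ideal_genM. Qed.

Lemma mnm_cong_exchange u v : u \in D -> v \in D ->
  mnm_cong (U_(u) + U_(f v)) (U_(v) + U_(f u)).
Proof. by move=> uD vD; rewrite /mnm_cong !mpolyXD mem_minor. Qed.

(* Exchanging two columns raises [f u] to [u] at the cost of lowering some other
   variable; the bound on [d u] says that the monomial can afford it. *)
Lemma raise_var u v (m : 'X_{1..N}) : (0 < m v)%N -> r v = r u -> (d v <= d u)%N ->
  (d u <= weight m ord0)%N ->
  exists m', [/\ mnm_cong m m', weight m = weight m', mdeg m = mdeg m'
             & (0 < m' u)%N].
Proof.
move=> mv; elim: {u}(d u) {-2}u (erefl (d u)) => [|k IHk] u du rvu dvu mu.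
  have uv : v = u by apply: root_depth_inj; rewrite // du; lia.
  by exists m; split; rewrite -?uv //; apply: mnm_cong_refl.
(* Either [v] already has the depth of [u], hence equals [u], or it is no deeper than [f u] and can
   first be raised to [f u]. *)
case: (eqVneq (d v) k.+1) => [dv|dv].
  have uv : v = u by apply: root_depth_inj; rewrite // du.
  by exists m; split; rewrite -?uv //; apply: mnm_cong_refl.
have uD : u \in D by rewrite -depth_gt0 du.
move: (rd u); rewrite uD du => -[ru /succn_inj dfu].
have [|||m1 [mm1 Wm1 degm1 m1u]] := IHk (f u) (esym dfu).
- by rewrite rvu.
- by lia.
- by lia.
have [n Dm1] := mnm_gt0P m1u.
(* The total depth is at least [d u], one more than [d (f u)], so removing [f u] leaves some
   variable [w] of [D] that can be lowered to [f w]. *)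
have : (0 < weight n ord0)%N.
  move: mu; rewrite du Wm1 Dm1 weightD weightU /var_weight !mnmDE mulmnE !mnm1E.
  by rewrite eqxx -dfu /=; lia.
rewrite weight_depth lt0n sum_nat_eq0 => /forall_inPn[w _].
rewrite muln_eq0 negb_or -!lt0n depth_gt0 => /andP[wD nw].
have [n' Dn] := mnm_gt0P nw.
have Em1 : m1 = (n' + (U_(w) + U_(f u)))%MM.
  by rewrite Dm1 Dn addmA addmC (addmC U_(w)%MM).
exists (n' + (U_(u) + U_(f w)))%MM; split.
- by apply: (mnm_cong_trans mm1); rewrite Em1; apply/mnm_congD/mnm_cong_exchange.
- by rewrite Wm1 Em1 !weightD !weightU var_weight_exchange.
- by rewrite degm1 Em1 !mdegD !mdeg1.
- by rewrite !mnmDE mnm1E eqxx; lia.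
Qed.

(** Induction on the degree: [raise_var] makes the two monomials share a variable, which is then
    cancelled. *)
Lemma mnm_cong_weight m m' : weight m = weight m' -> mnm_cong m m'.
Proof.
elim: {m}(mdeg m) {-2}m (erefl (mdeg m)) m' => [|k IHk] m degm m' Wmm'.
  have m0 : m = 0%MM by apply/eqP; rewrite -mdeg_eq0 degm.
  suff -> : m' = 0%MM by rewrite m0; apply: mnm_cong_refl.
  apply/mnmP => u; move/mnmP/(_ (lift ord0 (r u))): Wmm'; rewrite !weight_root m0.
  rewrite big1 => [/esym/eqP|v _]; last by rewrite mnm0E.
  by rewrite sum_nat_eq0 => /forall_inP/(_ u (eqxx _))/eqP->; rewrite mnm0E.
have cancel_var u n n' : mdeg (U_(u) + n)%MM = k.+1 ->
    weight (U_(u) + n)%MM = weight (U_(u) + n')%MM ->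
    mnm_cong (U_(u) + n) (U_(u) + n').
  rewrite mdegD mdeg1 !weightD => -[degn] Wn.
  by apply/mnm_congD/IHk => //; apply: addmI Wn.
have [u mu] : exists u, (0 < m u)%N.
  apply/existsP; apply: contra_eqT degm; rewrite negb_exists => /forallP m0.
  by rewrite mdegE big1 // => u _; apply/eqP; rewrite -leqn0 leqNgt m0.
(* The exponent of the variable for [r u] is positive in the common weight, so [m'] also contains a
   variable with that root. *)
have [v rvu m'v] : exists2 v, r v = r u & (0 < m' v)%N.
  have : (0 < weight m' (lift ord0 (r u)))%N.
    by rewrite -Wmm' weight_root (bigD1 u) //= ltn_addr.
  rewrite weight_root lt0n sum_nat_eq0 => /forall_inPn[v /eqP rvu].
  by rewrite -lt0n; exists v.
have depth_le w (n : 'X_{1..N}) : (0 < n w)%N -> (d w <= weight n ord0)%N.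
  by move=> nw; rewrite weight_depth (bigD1 w) //=; nia.
(* The shallower of [u] and [v] is raised to the other one; [depth_le] and the equality of weights
   give the bound that this requires. *)
have [dvu|/ltnW duv] := leqP (d v) (d u).
  have [|m1 [mm1 Wm1 _ m1u]] := raise_var m'v rvu dvu.
    by rewrite -Wmm' depth_le.
  apply: mnm_cong_trans (mnm_cong_sym mm1).
  have [n Dm] := mnm_gt0P mu; have [n1 Dm1] := mnm_gt0P m1u.
  by rewrite Dm Dm1; apply: cancel_var; rewrite -Dm -?Dm1 // -Wm1.
have [|m1 [mm1 Wm1 degm1 m1v]] := raise_var mu (esym rvu) duv.
  by rewrite Wmm' depth_le.
apply: mnm_cong_trans mm1 _.
have [n Dm'] := mnm_gt0P m'v; have [n1 Dm1] := mnm_gt0P m1v.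
by rewrite Dm' Dm1; apply: cancel_var; rewrite -Dm1 -?Dm' -?degm1 // -Wm1.
Qed.

Let torus : {mpoly K[N]} -> {mpoly K[N.+1]} :=
  mmap (mpolyC N.+1 (R := K)) (fun u => 'X_[var_weight u]).


(** The kernel of a ring morphism into a domain is prime. Minors die under [torus] because exchanges
    preserve weight; conversely, monomials of equal weight are congruent, so the fibre argument
    applies to the kernel. *)
Lemma prime_ideal_scroll : prime_ideal (ideal_gen G).
Proof.
have torusX m : torus 'X_[m] = 'X_[weight m].
  rewrite /torus mmapX /mmap1 -mprodXE.
  by apply: eq_bigr => u _; rewrite mpolyXn.
have torus_ideal p : p \in ideal_gen G -> torus p = 0.
  move: p; apply: ideal_gen_ind => [|p q p0 q0|a g].
  - by rewrite /torus rmorph0.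
  - by rewrite /torus rmorphD /= -!/(torus _) p0 q0 addr0.
  - move=> /minor_of_G[u [v [uD vD ->]]].
    rewrite /torus rmorphM rmorphB /= -!/(torus _) -!mpolyXD !torusX.
    by rewrite !weightD !weightU var_weight_exchange // subrr mulr0.
have torus_ker p : torus p = 0 -> p \in ideal_gen G.
  move=> p0; apply: (mem_ideal_gen_fiber mnm_cong_weight); rewrite -[RHS]p0.
  apply: eq_bigr => m _; by rewrite mul_mpolyC -torusX /torus mmapX.
split; last first.
  move=> p q /torus_ideal; rewrite /torus rmorphM /= -!/(torus _) => /eqP.
  by rewrite mulf_eq0 => /orP[] /eqP/torus_ker->; rewrite ?orbT.
split; first exact: ideal_gen0.
  by apply/negP => /torus_ideal/eqP; rewrite /torus rmorph1 oner_eq0.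
by move=> a p q pG qG; rewrite ideal_genD ?ideal_genM.
Qed.

End Scroll.

(** * Roots and depths from acyclicity *)

Lemma root_depth_exists (N : nat) (f : 'I_N -> 'I_N) (D : {pred 'I_N})
    (mu : 'I_N -> nat) : {in D, forall u, (mu (f u) < mu u)%N} ->
  exists (r : 'I_N -> 'I_N) (d : 'I_N -> nat), forall u,
    if u \in D then r u = r (f u) /\ d u = (d (f u)).+1
    else r u = u /\ d u = 0%N.
Proof.
move=> muD.
have exit u : exists k, iter k f u \notin D.
  elim/ltn_ind: {u}(mu u) {-2}u (erefl (mu u)) => k IHk u mu_u.
  have [uD|uD] := boolP (u \in D); last by exists 0%N.
  have [|l fuD] := IHk (mu (f u)) _ (f u) erefl; first by rewrite -mu_u muD.
  by exists l.+1; rewrite iterSr.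
exists (fun u => iter (ex_minn (exit u)) f u), (fun u => ex_minn (exit u)) => u.
case: ex_minnP => k kD k_min; case: ifP => [uD|/negbT uD]; last first.
  by have /k_min : iter 0 f u \notin D by []; rewrite leqn0 => /eqP->.
case: ex_minnP => l lD l_min.
(* First exit times: [k] is positive because [u] lies in [D], and minimality on both sides makes it
   one more than the exit time [l] of [f u]. *)
suff -> : k = l.+1 by rewrite iterSr.
case: k kD k_min => [|k] kD k_min; first by rewrite /= uD in kD.
apply/eqP; rewrite eqSS eqn_leq l_min -?iterSr // andbT -ltnS.
by apply: k_min; rewrite iterSr.
Qed.

(** Ancestors of [i] are ancestors of [j], while [j] itself is not an ancestor of [i]: a path back
    would close a cycle. This supplies the decreasing measure for the descent along [f]. *)
Lemma acyclic_connect_ltn (T : finType) (e : rel T) (i j : T) :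
  irreflexive e -> ~ has_directed_cycle e -> e i j ->
  (#|[set k | connect e k i]| < #|[set k | connect e k j]|)%N.
Proof.
move=> e_irr e_acyclic eij; apply/proper_card/properP; split.
  apply/subsetP => k; rewrite !inE => ki.
  exact: connect_trans ki (connect1 eij).
exists j; rewrite inE ?connect0 //; apply/negP.
move=> /connectP[p0 /shortenP[p ep uniq_p _] ip].
apply: e_acyclic; exists (j :: p); split.
  (* An empty path would make the edge a loop, so the cycle has at least two vertices. *)
  by case: p ip {ep uniq_p} => //= ij; rewrite ij e_irr in eij.
by rewrite /ucycle uniq_p andbT /= rcons_path ep -ip.
Qed.

(** * Explicit minors and their linear parts *)

Lemma is_minor2P (R : comNzRingType) (n : nat) (x z : 'I_n -> R) p :
  is_minor 2 (col_mx (\row_j x j) (\row_j z j) : 'M_(1 + 1, n)) p <->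
  exists i j : 'I_n, (i < j)%N /\ p = x i * z j - x j * z i.
Proof.
have minorE (f : 'I_2 -> 'I_(1 + 1)) (g : 'I_2 -> 'I_n) :
    {homo f : i j / (i < j)%N} ->
    \det (mxsub f g (col_mx (\row_j x j) (\row_j z j))) =
    x (g ord0) * z (g ord_max) - x (g ord_max) * z (g ord0).
  move=> f_mono.
  have f01 : (f ord0 < f ord_max)%N by apply: f_mono.
  (* An increasing selection of two rows out of two is the identity. *)
  have [f0 f1] : f ord0 = 0%N :> nat /\ f ord_max = 1%N :> nat.
    by move: f01 (ltn_ord (f ord0)) (ltn_ord (f ord_max)); lia.
  rewrite (expand_det_row _ ord0) !big_ord_recl big_ord0 addr0.
  rewrite /cofactor !det_mx11 !mxE /=.
  have -> : f ord0 = lshift 1 ord0 by apply: val_inj.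
  have -> : f (lift ord0 0) = rshift 1 ord0.
    by apply: val_inj; rewrite -[RHS]f1; congr (val (f _)); apply: val_inj.
  have -> : lift ord0 ord0 = ord_max :> 'I_2 by apply: val_inj.
  have -> : g (lift ord_max 0) = g ord0 by congr g; apply: val_inj.
  rewrite (unsplitK (inl _)) (unsplitK (inr _)) !mxE /= expr0 expr1.
  by rewrite mul1r mulN1r mulrN.
split=> [[f [g [f_mono g_mono ->]]]|[i [j [ij ->]]]].
  by exists (g ord0), (g ord_max); rewrite minorE //; split=> //; apply: g_mono.
exists id, (fun k => if k == ord0 then i else j); rewrite minorE //; split=> // k l.
by case: k l => [[|[|//]] ltk] [[|[|//]] ltl].
Qed.

(** The generators vanish to order two at the origin, and the Leibniz rule passes this on to their
    multiples. Values of derivatives at the origin stand for the coefficients of the linear part. *)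
Lemma linear_part_minor2 (K : fieldType) (N : nat) (G : {mpoly K[N]} -> Prop) :
  (forall g, G g -> exists i j k l : 'I_N, g = 'X_i * 'X_j - 'X_k * 'X_l) ->
  {in ideal_gen G, forall p,
     p.@[fun=> 0] = 0 /\ forall u, (p^`M(u)).@[fun=> 0] = 0}.
Proof.
move=> GE; apply: ideal_gen_ind => [|p q [p0 dp] [q0 dq]|a g].
- by split=> [|u]; rewrite !raddf0.
- by split=> [|u]; rewrite ?mderivD mevalD ?p0 ?q0 ?dp ?dq addr0.
move=> /GE[i [j [k [l ->]]]].
split=> [|u]; rewrite ?(mderivM, mderivB) !(mevalB, mevalD, mevalN, mevalM, mevalXU) /=;
  by rewrite ?(mul0r, mulr0, oppr0, addr0).
Qed.

(** * Directed cycles against primality *)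

Theorem theorem2p5 (K : fieldType) (n : nat)
    (z : 'I_n -> {mpoly K[n + n]})
    (z_var : forall i, (exists j, z i = xvar K j) \/ (exists j, z i = yvar K j))
    (z_inj : injective z)
    (z_neq : forall i, z i <> xvar K i) :
  prime_ideal (ideal_gen (is_minor 2 (Xmx z))) <->
  ~ has_directed_cycle (GX z).
Proof.
have minorP := is_minor2P (fun j => xvar K j) z.
have mem_minor i j : xvar K i * z j - xvar K j * z i \in
    ideal_gen (is_minor 2 (Xmx z)).
  case: (ltngtP i j) => [ij|ji|/val_inj->]; last by rewrite subrr ideal_gen0.
  - by apply/mem_ideal_gen/minorP; exists i, j.
  - by rewrite -opprB; apply/ideal_genN/mem_ideal_gen/minorP; exists j, i.
have /fin_all_exists[f0 zE] i : exists u, z i = 'X_u.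
  by case: (z_var i) => -[j ->]; [exists (lshift n j) | exists (rshift n j)].
split=> [[_ I_prime] [c [c_gt1 /andP[c_cycle c_uniq]]]|acyclic].
  case: c c_gt1 c_cycle c_uniq => [|a [|b c']] // _.
  set c := [:: a, b & c'] => c_cycle c_uniq.
  have linear_part : {in ideal_gen (is_minor 2 (Xmx z)), forall p,
      p.@[fun=> 0] = 0 /\ forall u, (p^`M(u)).@[fun=> 0] = 0}.
    apply: linear_part_minor2 => _ /minorP[i [j [_ ->]]].
    by exists (lshift n i), (f0 j), (lshift n j), (f0 i); rewrite !zE.
  have edge i : i \in c -> xvar K i = z (next c i).
    by move=> ic; apply/eqP; apply: (next_cycle c_cycle ic).
  have ab : b != a.
    by move: c_uniq; rewrite /c /= inE negb_or eq_sym => /andP[/andP[]].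
  (* The successor map permutes the cycle, so the sum of its variables can be reindexed. *)
  have c_next : perm_eq (map (next c) c) c.
    apply: uniq_perm => // [|i].
      by rewrite (map_inj_uniq (can_inj (prev_next c_uniq))).
    apply/mapP/idP => [[j jc ->]|ic]; first by rewrite mem_next.
    by exists (prev c i); rewrite ?mem_prev ?next_prev.
  have prod_mem : (xvar K b - xvar K a) * \sum_(i <- c) xvar K i \in
      ideal_gen (is_minor 2 (Xmx z)).
    have sum_next : \sum_(i <- c) xvar K (next c i) = \sum_(i <- c) xvar K i.
      by rewrite -[RHS](perm_big _ c_next) big_map.
    rewrite mulrBl -[X in _ - _ * X]sum_next !mulr_sumr -sumrB.
    apply: ideal_gen_sum => i ic.
    (* The term at [i] is the minor on the columns [b] and [next c i], whose lower entries are
       [xvar K a] and [xvar K i]. *)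
    have -> : xvar K a = z b by rewrite edge ?inE ?eqxx //= eqxx.
    by rewrite (edge i) // [z b * _]mulrC mem_minor.
  have dvar i j : ((xvar K i)^`M(lshift n j)).@[fun=> 0] = (i == j)%:R.
    rewrite mderivX mevalZ mnm1E (inj_eq (@lshift_inj n n)).
    case: eqP => [->|_]; last by rewrite mul0r.
    rewrite (_ : (_ - _)%MM = 0%MM) ?mpolyX0 ?meval1 ?mulr1 //.
    by apply/mnmP => k; rewrite mnmBE subnn mnm0E.
  (* Neither factor has zero linear part: the coefficient of [xvar K b] in the first is 1 since [a]
     and [b] differ, and that of [xvar K a] in the sum is 1 since [a] occurs once in [c]. *)
  case/orP: (I_prime _ _ prod_mem) => /linear_part[_].
    move/(_ (lshift n b)); rewrite mderivB mevalB !dvar eqxx eq_sym (negPf ab).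
    by move/eqP; rewrite subr0 oner_eq0.
  move/(_ (lshift n a)); rewrite (raddf_sum (mderiv _)) raddf_sum.
  under eq_bigr do rewrite /= dvar.
  rewrite (bigD1_seq a) ?inE ?eqxx //= big1 => [|i /negPf->] //.
  by move/eqP; rewrite addr0 oner_eq0.
(* [f] sends each x-variable to the entry below it and is extended by the identity on the
   y-variables. *)
pose f u := match split u with inl j => f0 j | inr _ => u end.
pose D : {pred 'I_(n + n)} := [pred u : 'I_(n + n) | (u < n)%N].
have inD u : u \in D -> exists j, u = lshift n j.
  rewrite inE; case: (split_ordP u) => j -> //=; by exists j.
have fl j : f (lshift n j) = f0 j by rewrite /f (unsplitK (inl _)).
(* If the entry below [x_j] is [x_i], then [i -> j] is an edge, so the number of ancestors drops
   along [f]. It is positive, as [j] counts itself, so the value 0 makes y-variables lowest. *)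
pose mu (u : 'I_(n + n)) : nat := match split u with
  | inl j => #|[set i | connect (GX z) i j]| | inr _ => 0%N end.
have mu_l j : mu (lshift n j) = #|[set i | connect (GX z) i j]|.
  by rewrite /mu (unsplitK (inl _)).
have GX_irr : irreflexive (GX z) by move=> i; apply/eqP => /esym/z_neq.
have [|r [d rd]] := @root_depth_exists _ f D mu.
  move=> _ /inD[j ->]; rewrite fl mu_l.
  case: (split_ordP (f0 j)) => i f0j; rewrite f0j.
    rewrite mu_l; apply: acyclic_connect_ltn => //.
    by rewrite /GX /= zE f0j.
  rewrite {1}/mu (unsplitK (inr _)); apply/card_gt0P; exists j.
  by rewrite inE connect0.
apply: (@prime_ideal_scroll K _ f D r d) => //.
- move=> _ _ /inD[i ->] /inD[j ->]; rewrite !fl => f0ij.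
  by congr lshift; apply: z_inj; rewrite !zE f0ij.
- by move=> _ _ /inD[i ->] /inD[j ->]; rewrite !fl -!zE; apply: mem_minor.
- move=> g /minorP[i [j [_ ->]]]; exists (lshift n i), (lshift n j).
  by rewrite !fl -!zE !inE /= !ltn_ord.
Qed.
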